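(* For every integer $n \geq 1$, $$\sum_{k=1}^{n} L(n,k)\, x^k = (-1)^n \sum_{j=0}^{n} s(n,j)\,(-1)^j \varphi_j(x)$$ as polynomials in $x$, where $L(n,k)$ are the Lah numbers, $s(n,j)$ are the (signed) Stirling numbers of the first kind, and $\varphi_j$ are the exponential polynomials.
   Context: The Lah numbers are $L(n,k) = \frac{n!}{k!}\binom{n-1}{k-1}$ for $1 \leq k \leq n$. The numbers $s(n,k)$ are the signed Stirling numbers of the first kind, $y(y-1)\cdots(y-n+1) = \sum_{k=0}^n s(n,k)\, y^k$, and $S(n,k)$ are the Stirling numbers of the second kind, $y^n=\sum_{k=0}^n S(n,k)\,y(y-1)\cdots(y-k+1)$. The exponential polynomials (single-variable Bell polynomials) are $\varphi_m(x) = \sum_{k=0}^{m} S(m,k)\, x^k$, $m=0,1,2,\ldots$ *)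

(* Defs.v *)
From mathcomp Require Import all_boot all_order all_algebra.

Set Implicit Arguments.
Unset Strict Implicit.
Unset Printing Implicit Defensive.

Import GRing.Theory.
Local Open Scope ring_scope.

(* y (y - 1) ... (y - n + 1), as a polynomial in y *)
Definition falling (n : nat) : {poly int} := \prod_(i < n) ('X - (i%:R)%:P).

Definition stirling1 (n k : nat) : int := (falling n)`_k.

Lemma falling_monic n : falling n \is monic.
Proof. by apply: monic_prod => i _; apply: monicXsubC. Qed.

Lemma size_falling n : size (falling n) = n.+1.
Proof. by rewrite /falling size_prod_XsubC /index_enum -enumT size_enum_ord. Qed.

Lemma mulX_falling n : 'X * falling n = falling n.+1 + n%:R *: falling n.
Proof.
rewrite /falling big_ord_recr /= -/(falling n) -mul_polyC.
by rewrite [_ * ('X - _)]mulrC -mulrDl subrK.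
Qed.

Lemma stirling2_ex n : exists c : {ffun 'I_n.+1 -> int},
  'X^n == \sum_(k < n.+1) c k *: falling k.
Proof.
suff [c Hc] : exists c : nat -> int,
    'X^n = \sum_(k < n.+1) c k *: falling k.
  exists [ffun k : 'I_n.+1 => c k]; rewrite Hc; apply/eqP.
  by apply: eq_bigr => k _; rewrite ffunE.
elim: n => [|n [c Hc]].
  by exists (fun=> 1); rewrite big_ord1 /falling big_ord0 scale1r expr0.
exists (fun k => (if k is k'.+1 then c k' else 0) +
                 (if (k <= n)%N then k%:R * c k else 0)).
rewrite exprS Hc mulr_sumr.
under [RHS]eq_bigr do rewrite scalerDl.
rewrite big_split /= [X in X + _]big_ord_recl scale0r add0r.
rewrite [X in _ + X]big_ord_recr /= ltnn scale0r addr0 -big_split /=.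
apply: eq_bigr => k _; rewrite -ltnS ltn_ord -scalerAr mulX_falling.
by rewrite scalerDr scalerA mulrC.
Qed.

(* The coordinates of y^n in the basis of falling factorials; they are unique
   by falling_free, and stirling2P, stirling2_unique characterize them. *)
Definition stirling2 (n k : nat) : int :=
  if insub k is Some i then xchoose (stirling2_ex n) i else 0.

Lemma stirling2P n : 'X^n = \sum_(k < n.+1) stirling2 n k *: falling k.
Proof.
rewrite {1}(eqP (xchooseP (stirling2_ex n))).
by apply: eq_bigr => k _; rewrite /stirling2 valK.
Qed.

Lemma falling_free n (c : nat -> int) :
  \sum_(k < n) c k *: falling k = 0 -> forall k, (k < n)%N -> c k = 0.
Proof.
elim: n => // n IHn; rewrite big_ord_recr /= => Hs.
have cn0 : c n = 0.
  have := congr1 (fun p : {poly int} => p`_n) Hs.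
  rewrite coefD coefZ coef0.
  have -> : (falling n)`_n = 1.
    by have := monicP (falling_monic n); rewrite lead_coefE size_falling.
  rewrite mulr1 coef_sum big1 ?add0r // => i _.
  by rewrite coefZ nth_default ?mulr0 // size_falling.
move: Hs; rewrite cn0 scale0r addr0 => /IHn c0 k.
by rewrite ltnS leq_eqVlt => /predU1P[->|/c0].
Qed.

Lemma stirling2_unique n (c : nat -> int) :
  'X^n = \sum_(k < n.+1) c k *: falling k ->
  forall k, (k <= n)%N -> c k = stirling2 n k.
Proof.
move=> Hc k le_kn; apply/eqP; rewrite -subr_eq0; apply/eqP.
apply: (@falling_free n.+1 (fun k => c k - stirling2 n k)) => //.
under eq_bigr do rewrite scalerBl.
by rewrite sumrB -Hc -stirling2P subrr.
Qed.

Definition exp_poly (m : nat) : {poly int} :=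
  \sum_(0 <= k < m.+1) stirling2 m k *: 'X^k.

(* Meaningful for 1 <= k <= n, where the division is exact: see lahE. *)
Definition lah (n k : nat) : nat := (n`! %/ k`! * 'C(n.-1, k.-1))%N.

Lemma lahE n k : (1 <= k <= n)%N ->
  (lah n k)%:R = n`!%:R / k`!%:R * 'C(n.-1, k.-1)%:R :> rat.
Proof.
move=> /andP[_ le_kn]; have k0 : (k`!%:R : rat) != 0.
  by rewrite Num.Theory.pnatr_eq0 -lt0n fact_gt0.
have dv : (k`! %| n`!)%N.
  by rewrite -(bin_fact le_kn) mulnCA dvdn_mulr.
by rewrite /lah natrM -{2}(divnK dv) natrM mulfK.
Qed.

(* Main.v *)
(** Let T be the linear map sending y(y-1)...(y-k+1) to x^k, so that
    phi_j = T(y^j).  The right-hand side is then T applied to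
    (-1)^n (-y)(-y-1)...(-y-n+1) = y(y+1)...(y+n-1), and the Lah numbers are
    the coordinates of this rising factorial in the falling factorial basis. *)

Require Import Defs.
From mathcomp Require Import all_boot all_order all_algebra.
From mathcomp Require Import zify.

Import GRing.Theory.
Local Open Scope ring_scope.

Definition rising (n : nat) : {poly int} := \prod_(i < n) ('X + (i%:R)%:P).

Lemma rising_falling n : rising n = (-1) ^+ n *: (falling n \Po - 'X).
Proof.
rewrite /rising /falling; elim: n => [|n IHn].
  by rewrite !big_ord0 rmorph1 expr0 scale1r.
rewrite !big_ord_recr /= IHn rmorphM rmorphB /= comp_polyX comp_polyC exprS.
rewrite -scalerA scaleN1r -opprD mulrN scalerN opprK.
by rewrite -scalerAl.
Qed.

Lemma rising_stirling1 n :
  rising n = (-1) ^+ n *: \sum_(j < n.+1) (stirling1 n j * (-1) ^+ j) *: 'X^j.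
Proof.
rewrite rising_falling comp_polyE size_falling; congr (_ *: _).
by apply: eq_bigr => j _; rewrite -scaleN1r exprZn scalerA.
Qed.

(* lah n 0 is the junk value n`!, whereas the coordinate on falling 0 is 0. *)
Definition lah_coord (n k : nat) : nat := if k is 0%N then 0%N else lah n k.

(** Clears the division in [lah]: for [k <= n] the quotient of factorials is exact, and for larger
    [k] the binomial makes both sides vanish. *)
Lemma lah_fact n k : (lah n.+1 k.+1 * k.+1`! = n.+1`! * 'C(n, k))%N.
Proof.
rewrite /lah /=; case: (leqP k n) => [le_kn|lt_nk]; last by rewrite bin_small // !muln0.
have dv : (k.+1`! %| n.+1`!)%N.
  by rewrite -(@bin_fact n.+1 k.+1) // mulnCA dvdn_mulr.
by rewrite mulnAC divnK.
Qed.

Lemma lah_coord_small n k : (n.+1 < k)%N -> lah_coord n.+1 k = 0.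
Proof. by case: k => // k lt_nk; rewrite /= /lah bin_small ?muln0. Qed.

(** The recurrence matches the passage from [rising n.+1] to [rising n.+2] in the falling basis. It
    is checked after multiplication by the factorial of [k.+1], where [lah_fact] leaves only
    binomials. *)
Lemma lah_coordS n k :
  lah_coord n.+2 k.+1 =
  (lah_coord n.+1 k + (n.+1 + k.+1) * lah_coord n.+1 k.+1)%N.
Proof.
apply/eqP; rewrite -(@eqn_pmul2r k.+1`!) ?fact_gt0 //= mulnDl -mulnA !lah_fact.
case: k => [|k] /=.
  by rewrite !bin0 !muln1 addn1 -factS.
rewrite [k.+2`!]factS mulnCA lah_fact [n.+2`!]factS binS.
case: (leqP k n) => [/subnKC def_n|lt_nk]; last by rewrite !bin_small ?muln0 // ltnW.
(* Up to a common factorial, the goal reduces to [k.+1 * 'C(n, k.+1) = (n - k) * 'C(n, k)]. *)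
have := mul_bin_left n k.
move: (n.+1`!) 'C(n, k) 'C(n, k.+1) (n - k)%N def_n => F b c d <- bin_left.
apply/eqP; nia.
Qed.

(** Split ['X + n] as [('X - k) + (n + k)]. *)
Lemma falling_mul_addX n k :
  falling k * ('X + (n%:R)%:P) = falling k.+1 + (n + k)%:R *: falling k.
Proof.
rewrite mulrDr [_ * 'X]mulrC mulX_falling -addrA; congr (_ + _).
by rewrite [_ * _%:P]mulrC mul_polyC -scalerDl -natrD addnC.
Qed.

Lemma rising_lah n :
  rising n.+1 = \sum_(k < n.+2) (lah_coord n.+1 k)%:R *: falling k.
Proof.
elim: n => [|n IHn].
  by rewrite /rising /falling !big_ord_recr !big_ord0 /= scale0r scale1r subr0 addr0 !add0r.
rewrite {1}/rising big_ord_recr -/(rising n.+1) /= IHn mulr_suml.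
under [LHS]eq_bigr do rewrite -scalerAl falling_mul_addX scalerDr scalerA -natrM.
rewrite big_split /= [RHS]big_ord_recl scale0r add0r.
under [RHS]eq_bigr do rewrite lah_coordS natrD scalerDl.
rewrite [RHS]big_split /=; congr (_ + _).
(* The two sums are offset by one: the left one starts at [falling 0] and the right one ends at
   [falling n.+2], both with coefficient 0. *)
rewrite [LHS]big_ord_recl mul0n scale0r add0r [RHS]big_ord_recr /=.
rewrite (_ : lah n.+1 n.+2 = 0%N); last exact: (@lah_coord_small n n.+2).
by rewrite muln0 scale0r addr0; apply: eq_bigr => i _; rewrite mulnC.
Qed.

Lemma stirling2_small n k : (n < k)%N -> stirling2 n k = 0.
Proof. by move=> lt_nk; rewrite /stirling2 insubF // ltnS leqNgt lt_nk. Qed.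

Lemma stirling2_sum_widen (V : lmodType int) m n (b : nat -> V) : (m <= n)%N ->
  \sum_(k < m.+1) stirling2 m k *: b k = \sum_(k < n.+1) stirling2 m k *: b k.
Proof.
move=> le_mn.
rewrite (big_ord_widen n.+1 (fun k => stirling2 m k *: b k)) // big_mkcond.
apply: eq_bigr => k _; case: ltnP => // lt_mk.
by rewrite stirling2_small ?scale0r.
Qed.

(** Stands in for the map T: the inner sums are ['X^j] when [b] is [falling], and [exp_poly j] when
    [b k] is ['X^k], while the outer coefficients stay the same. *)
Lemma stirling2_sum_exchange (V : lmodType int) n (a : nat -> int) (b : nat -> V) :
  \sum_(j < n.+1) a j *: (\sum_(k < j.+1) stirling2 j k *: b k) =
  \sum_(k < n.+1) (\sum_(j < n.+1) a j * stirling2 j k) *: b k.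
Proof.
under [RHS]eq_bigr do rewrite scaler_suml.
rewrite exchange_big /=; apply: eq_bigr => j _.
rewrite (@stirling2_sum_widen _ _ n) -1?ltnS // scaler_sumr.
by apply: eq_bigr => k _; rewrite scalerA.
Qed.

(** Both sides are coordinates of [rising n.+1] on [falling k], one from [rising_lah], the other
    from [rising_stirling1]; [falling_free] identifies them. *)
Lemma lah_coord_stirling n k : (k <= n.+1)%N ->
  (lah_coord n.+1 k)%:R =
  (-1) ^+ n.+1 *
  \sum_(j < n.+2) stirling1 n.+1 j * (-1) ^+ j * stirling2 j k.
Proof.
move=> le_kn; apply/eqP; rewrite -subr_eq0; apply/eqP.
pose d k := (lah_coord n.+1 k)%:R - (-1) ^+ n.+1 *
  \sum_(j < n.+2) stirling1 n.+1 j * (-1) ^+ j * stirling2 j k.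
apply: (@falling_free n.+2 d) => //; rewrite {}/d.
under eq_bigr do rewrite scalerBl -scalerA.
rewrite sumrB -rising_lah rising_stirling1 -scaler_sumr.
(* Read backwards with [b] equal to [falling], the exchange recovers the powers ['X^j]. *)
rewrite -(stirling2_sum_exchange _ _ (fun j => stirling1 n.+1 j * (-1) ^+ j)).
by under [X in _ - _ *: X]eq_bigr do rewrite -stirling2P; rewrite subrr.
Qed.

Theorem mainTheorem4 (n : nat) (hn : (1 <= n)%N) :
  \sum_(1 <= k < n.+1) (lah n k)%:R *: 'X^k =
  (-1) ^+ n *: \sum_(0 <= j < n.+1) (stirling1 n j * (-1) ^+ j) *: exp_poly j
    :> {poly int}.
Proof.
case: n hn => // n _.
(* Passing to [lah_coord] adds a zero term at [k = 0], so that both sides range over the same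
   indices. *)
transitivity (\sum_(k < n.+2) (lah_coord n.+1 k)%:R *: 'X^k : {poly int}).
  by rewrite big_ord_recl scale0r add0r big_add1 big_mkord.
rewrite big_mkord /exp_poly.
under [in RHS]eq_bigr do rewrite big_mkord.
rewrite (stirling2_sum_exchange _ _ (fun j => stirling1 n.+1 j * (-1) ^+ j)).
rewrite scaler_sumr; apply: eq_bigr => k _.
by rewrite scalerA -lah_coord_stirling // -ltnS.
Qed.
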